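(* Fix $\mu_0\in\mathcal P(X_0)$ and $\mu_K\in\mathcal P(X_K)$. Suppose there exist intermediate measures $\mu_k\in\mathcal P(\widehat X_k)$, $k=1,\dots,K-1$, such that $$\sum_{i=0}^{K-1}\tilde C_{i,i+1}(\mu_i,\mu_{i+1})<\infty .$$ Then the optimal value $$M:=\inf\Big\{\int_\Omega c\,d\pi \ :\ \mu'_k\in\mathcal P(\widehat X_k)\ (1\le k\le K-1),\ \pi\in\Pi(\mu_0,\mu'_1,\dots,\mu'_{K-1},\mu_K)\Big\}$$ is finite.
   Context: Let $K\ge 1$ and let $X_0,\dots,X_K$ be Polish spaces. For $1\le k\le K-1$ let $\widehat X_k:=X_k\cup\{\partial_k\}$, where $\partial_k\notin X_k$ is added as an isolated point (so $\widehat X_k$ is Polish); put $\widehat X_0:=X_0$, $\widehat X_K:=X_K$. $\mathcal P(\cdot)$ denotes the set of Borel probability measures. The path space is $\Omega:=\prod_{k=0}^K\widehat X_k$ with the product topology, and $T_k:\Omega\to\widehat X_k$ is the $k$-th projection. $\Pi(\mu_0,\dots,\mu_K)$ is the set of $\pi\in\mathcal P(\Omega)$ with $(T_k)_\#\pi=\mu_k$ for $k=0,\dots,K$; likewise $\Pi(\mu_i,\mu_{i+1})$ is the set of couplings on $\widehat X_i\times\widehat X_{i+1}$ with marginals $\mu_i,\mu_{i+1}$. For $\omega=(\widehat x_0,\dots,\widehat x_K)\in\Omega$, the active indices are $0=k_0<k_1<\dots<k_{n-1}=K$, where $\{k_1,\dots,k_{n-2}\}=\{1\le k\le K-1:\widehat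 x_k\in X_k\}$. Given lower semicontinuous functions $c_{i,j}:X_i\times X_j\to[0,+\infty]$, $0\le i<j\le K$, the path cost is $$c(\omega):=\sum_{l=0}^{n-2}c_{k_l,k_{l+1}}(\widehat x_{k_l},\widehat x_{k_{l+1}}).$$ For $0\le i\le K-1$ the maximum adjacent cost $\tilde c_{i,i+1}:\widehat X_i\times\widehat X_{i+1}\to[0,+\infty]$ is $$\tilde c_{i,i+1}(\widehat x_i,\widehat x_{i+1}):=\begin{cases}c_{i,i+1}(\widehat x_i,\widehat x_{i+1}) & \text{if }\widehat x_i\in X_i,\ \widehat x_{i+1}\in X_{i+1},\\ \sup\{c_{i,j}(\widehat x_i,x_j): i+1<j\le K,\ x_j\in X_j\} & \text{if }\widehat x_i\in X_i,\ \widehat x_{i+1}=\partial_{i+1},\\ 0&\text{otherwise,}\end{cases}$$ and $\tilde C_{i,i+1}(\mu_i,\mu_{i+1}):=\inf_{\pi_i\in\Pi(\mu_i,\mu_{i+1})}\int_{\widehat X_i\times\widehat X_{i+1}}\tilde c_{i,i+1}\,d\pi_i$. *)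

(* Defs.v *)
From HB Require Import structures.
From mathcomp Require Import all_boot all_order all_algebra.
From mathcomp Require Import all_classical all_reals all_analysis.

Set Implicit Arguments.
Unset Strict Implicit.
Unset Printing Implicit Defensive.

Import Order.TTheory GRing.Theory Num.Theory.

Local Open Scope classical_set_scope.
Local Open Scope ring_scope.
Local Open Scope ereal_scope.

(* Separable and homeomorphic to a complete metric space. *)
Definition polish (R : realType) (T : topologicalType) : Prop :=
  (exists2 D : set T, countable D & dense D) /\
  exists (M : metricType R) (f : T -> M) (g : M -> T),
    [/\ continuous f, continuous g, cancel f g, cancel g f &
      forall F : set_system M, ProperFilter F -> cauchy F -> exists x : M, F --> x].

(* T with an isolated point [None] added: a set is open iff its trace on T is.
   (The library's topology on an alias of [option T] is the one-point
   compactification, in which [None] is not isolated.) *)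
Definition add_isolated (T : Type) : Type := option T.

Section add_isolated_topology.
Variable T : topologicalType.

Definition add_isolated_open : set_system (add_isolated T) :=
  [set A | open (Some @^-1` A : set T)].

Let opT : add_isolated_open setT.
Proof. by rewrite /add_isolated_open /= preimage_setT; exact: openT. Qed.

Let opI : setI_closed add_isolated_open.
Proof.
by move=> A B oA oB; rewrite /add_isolated_open /= preimage_setI; exact: openI.
Qed.

Let op_bigU (I : Type) (f : I -> set (add_isolated T)) :
  (forall i, add_isolated_open (f i)) -> add_isolated_open (\bigcup_i f i).
Proof.
move=> of_; rewrite /add_isolated_open /= preimage_bigcup.
by apply: bigcup_open => i _; exact: of_.
Qed.

HB.instance Definition _ := Choice.copy (add_isolated T) (option T).
HB.instance Definition _ := Pointed.copy (add_isolated T) (option T).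
HB.instance Definition _ :=
  isOpenTopological.Build (add_isolated T) opT opI op_bigU.

End add_isolated_topology.

HB.instance Definition _ (I : Type) (T : I -> ptopologicalType) :=
  Pointed.copy (prod_topology T) (forall i, T i).
HB.instance Definition _ (S T : ptopologicalType) := Pointed.on (S * T)%type.

Definition borel (T : ptopologicalType) : measurableType (@open T).-sigma :=
  g_sigma_algebraType (@open T).

Definition has_marginal (R : realType) (S T : ptopologicalType)
    (pi : probability (borel S) R) (f : S -> T)
    (mu : probability (borel T) R) : Prop :=
  forall A : set (borel T), measurable A ->
    pushforward pi (f : borel S -> borel T) A = mu A.

Definition couplings (R : realType) (S T : ptopologicalType)
    (mu : probability (borel S) R) (nu : probability (borel T) R) :
    set (probability (borel (S * T)%type) R) :=
  [set pi | has_marginal pi fst mu /\ has_marginal pi snd nu].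

Section paths.
Variables (R : realType) (K : nat) (X : 'I_K.+1 -> ptopologicalType).
Implicit Types i j k : 'I_K.+1.

Definition inner k : bool := (0 < k < K)%N.

Definition hat k : ptopologicalType :=
  if inner k then (add_isolated (X k) : ptopologicalType) else X k.

(* [Some x] for a point x of X_k, [None] for the cemetery point. *)
Definition actual k : hat k -> option (X k) :=
  match inner k as b
    return ((if b then (add_isolated (X k) : ptopologicalType) else X k) ->
            option (X k)) with
  | true => fun x => x
  | false => fun x => Some x
  end.

Definition path_space : ptopologicalType := prod_topology hat.

Definition path_couplings (mu : forall k, probability (borel (hat k)) R) :
    set (probability (borel path_space) R) :=
  [set pi | forall k,
     has_marginal pi (fun omega : path_space => omega k) (mu k)].

(* Enumerated in increasing order; the endpoints 0 and K are always active. *)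
Definition active (omega : path_space) : seq 'I_K.+1 :=
  [seq k <- enum 'I_K.+1 | isSome (actual (omega k))].

(* Only the values c i j with i < j are used. *)
Variable c : forall i j, X i -> X j -> \bar R.

(* The default 0 is never reached from [path_cost]. *)
Definition hop_cost i j (x : hat i) (y : hat j) : \bar R :=
  match actual x, actual y with
  | Some a, Some b => c a b
  | _, _ => 0
  end.

Definition path_cost (omega : path_space) : \bar R :=
  let s := active omega in
  \sum_(0 <= l < (size s).-1)
    hop_cost (omega (nth ord0 s l)) (omega (nth ord0 s l.+1)).

Definition lidx (i : 'I_K) : 'I_K.+1 := widen_ord (leqnSn K) i.
Definition ridx (i : 'I_K) : 'I_K.+1 := lift ord0 i.

Definition max_adj_cost (i : 'I_K)
    (x : hat (lidx i)) (y : hat (ridx i)) : \bar R :=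
  match actual x, actual y with
  | Some a, Some b => c a b
  | Some a, None =>
      ereal_sup [set z | exists j (b : X j), (i.+1 < j)%N /\ z = c a b]
  | None, _ => 0
  end.

Definition max_adj_transport (i : 'I_K)
    (mu : probability (borel (hat (lidx i))) R)
    (nu : probability (borel (hat (ridx i))) R) : \bar R :=
  ereal_inf [set \int[pi]_p max_adj_cost p.1 p.2 | pi in couplings mu nu].

Definition optimal_value (mu0 : probability (borel (hat ord0)) R)
    (muK : probability (borel (hat ord_max)) R) : \bar R :=
  ereal_inf [set z |
    exists (mu : forall k, probability (borel (hat k)) R)
           (pi : probability (borel path_space) R),
      [/\ mu ord0 = mu0, mu ord_max = muK, path_couplings mu pi &
          z = \int[pi]_omega path_cost omega]].

End paths.

(* Main.v *)
(** A path measure whose consecutive two-dimensional marginals are given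
    couplings of finite cost is obtained by gluing them one after the other. Its
    cost is finite because a hop from k to l > k + 1 skips only cemetery points,
    so that it costs at most the supremum in the definition of the maximum
    adjacent cost at (k, k + 1).

    Gluing needs no disintegration theorem: if (u, v) has a given law and v is
    real, then (u, h(u, r)) has the same law when r is uniform and independent of
    u and h is the conditional quantile function, built from Radon-Nikodym
    derivatives at rational thresholds. A Polish space is reduced to the reals by
    a Borel map into [0, 1] with a Borel left inverse; its image need not be
    known to be Borel. *)
From HB Require Import structures.
Require Import Defs.
From mathcomp Require Import all_boot all_order all_algebra.
From mathcomp Require Import all_classical all_reals all_analysis.
From mathcomp Require Import measurable_realfun ring lra.

Set Implicit Arguments.
Unset Strict Implicit.
Unset Printing Implicit Defensive.

Import Order.TTheory GRing.Theory Num.Theory.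
Import numFieldNormedType.Exports.

Local Open Scope classical_set_scope.
Local Open Scope ring_scope.

(** * Polish spaces as Borel retracts of the real line *)

(** The path cost is dominated by a sum of functions of two adjacent coordinates, so nothing about
    the glued law is needed beyond its consecutive pair laws. Couplings are measures on the Borel
    sets of a product topology, whereas random variables are built coordinate by coordinate;
    countable bases are carried along to reconcile the two sigma-algebras. Gluing passes through the
    reals because there a law is determined by countably many rays: the null sets on which the
    Radon-Nikodym derivatives misbehave can then be discarded together. Codes of points use the
    ternary digits 0 and 2, as in the Cantor set, since these can be read off by Borel functions
    without ambiguity. *)

Definition countable_base (T : topologicalType) (B : nat -> set T) : Prop :=
  (forall n, open (B n)) /\
  forall (O : set T) x, open O -> O x -> exists2 n, B n x & B n `<=` O.

(** [D] is the metric of [M] pulled back along the homeomorphism. Completeness is turned here, once,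
    from filters to sequences, so that later arguments only handle inequalities between reals. *)
Lemma polish_metric (R : realType) (T : ptopologicalType) : polish R T ->
  exists (D : T -> T -> R) (d : nat -> T),
  [/\ (forall x y, D x y = 0 <-> x = y), (forall x y, D x y = D y x),
      (forall x y z, D x z <= D x y + D y z) &
      [/\ forall x (e : R), open [set y | D x y < e],
       (forall (O : set T) x, open O -> O x ->
          exists2 e : R, 0 < e & forall y, D x y < e -> O y),
       (forall x (e : R), 0 < e -> exists m, D x (d m) < e) &
       forall u : nat -> T,
         (forall e : R, 0 < e -> exists N, forall i j,
            (N <= i)%N -> (N <= j)%N -> D (u i) (u j) < e) ->
         exists x, forall e : R, 0 < e -> exists N, forall i,
            (N <= i)%N -> D (u i) x < e]].
Proof.
move=> [[Q cQ dQ] [M [f [g [cf cg fgK gfK cM]]]]].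
have openD x (e : R) : open [set y | mdist (f x) (f y) < e].
  have -> : [set y | mdist (f x) (f y) < e] = f @^-1` ball (f x) e.
    by rewrite ballEmdist.
  move/continuousP : cf; apply; rewrite openE => y /=.
  rewrite ballEmdist /= => xy; apply/nbhs_ballP.
  exists (e - mdist (f x) y); first by rewrite /= subr_gt0.
  move=> z; rewrite ballEmdist /= => yz.
  apply: (le_lt_trans (metric_triangle _ y _)); lra.
have Qx (x : T) (e : R) : 0 < e ->
    exists2 y, Q y & mdist (f x) (f y) < e.
  move=> e0; have [y [xy Qy]] : [set y | mdist (f x) (f y) < e] `&` Q !=set0.
    by apply: dQ => //; exists x => /=; rewrite mdistxx.
  by exists y.
(* A countable set is empty or the range of a sequence; density excludes the first case because [T]
   contains [point]. *)
have [d dQE] : exists d : nat -> T, range d = Q.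
  have /pfcard_geP[Q0|[d]] := cQ; last by exists d; rewrite image_eq.
  by have [y] := Qx point 1 ltr01; rewrite Q0.
exists (fun x y => mdist (f x) (f y)), d; split.
- move=> x y; split=> [/mdist_positivity fxy|->]; last by rewrite mdistxx.
  by rewrite -(fgK x) fxy fgK.
- by move=> x y; rewrite metric_sym.
- by move=> x y z; exact: metric_triangle.
split => //.
- move=> O x oO Ox.
  have /continuousP/(_ _ oO) := cg.
  rewrite openE => /(_ (f x)); rewrite /= fgK => /(_ Ox) /nbhs_ballP[e e0 H].
  by exists e => // y xy; rewrite -(fgK y); apply: H; rewrite ballEmdist.
- move=> x e e0; have [y Qy xy] := Qx x e e0; move: Qy.
  by rewrite -dQE => -[m _ dm]; exists m; rewrite dm.
- move=> u cu; have [|x ux] := cM (f \o u @ \oo) _.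
    apply/cauchy_ballP => e e0.
    have [N HN] := cu e e0.
    exists (f @` (u @` [set i | (N <= i)%N]), f @` (u @` [set i | (N <= i)%N])).
      by split; exists N => // i /= Ni; exists (u i) => //; exists i.
    move=> [_ _] [[_ [i /= Ni <-] <-] [_ [j /= Nj <-] <-]].
    by rewrite /= ballEmdist; exact: HN.
  exists (g x) => e e0.
  have /(_ (ball x e)) := ux; case; first exact: nbhsx_ballx.
  move=> N _ HN; exists N => i Ni.
  by rewrite gfK metric_sym; have := HN i Ni; rewrite /= ballEmdist.
Qed.

Lemma polish_countable_base (R : realType) (T : ptopologicalType) :
  polish R T -> exists B, @countable_base T B.
Proof.
move=> /polish_metric[D [d [D0 Dsym Dtri [oD Dn dd _]]]].
(* [n] codes a centre [d m] and a radius [1 / k.+1]. The default pair is harmless: it only repeats a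
   ball. *)
pose pk n := odflt (0, 0)%N (unpickle n) : nat * nat.
exists (fun n => [set x | (D (d (pk n).1) x < (pk n).2.+1%:R^-1)]).
split=> [n|O x oO Ox]; first exact: oD.
have [e e0 He] := Dn _ _ oO Ox.
have [k ke] : exists k, (k.+1%:R^-1 < e / 2 :> R).
  exists (Num.truncn (e / 2)^-1).
  by rewrite invf_plt ?posrE// ?divr_gt0// truncnS_gt.
have k0 : (0 < k.+1%:R^-1 :> R) by [].
have [m xm] := dd x _ k0.
exists (pickle (m, k)); rewrite /pk pickleK /=; first by rewrite Dsym.
move=> y /= my; apply: He; apply: (le_lt_trans (Dtri _ (d m) _)).
by rewrite (splitr e) ltrD// (lt_trans _ ke).
Qed.

Lemma borel_measurable_fun (d : measure_display) (W : measurableType d)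
    (T : ptopologicalType) (f : W -> borel T) :
  (forall O : set T, open O -> measurable (f @^-1` O)) ->
  measurable_fun setT f.
Proof.
move=> H.
apply: (@measurability _ _ W (borel T) setT f (@open T) erefl) => //.
move=> _ [A oA <-].
by rewrite setTI; exact: H.
Qed.

Lemma borel_open (T : ptopologicalType) (O : set T) :
  open O -> measurable (O : set (borel T)).
Proof. exact: sub_sigma_algebra. Qed.

(* Partial sums of [\sum_n 2 * \1_(B n) x / 3 ^ n.+1], by a recursion which is a
   shift of the sequence [B]. *)
Fixpoint cantor_sum (R : realType) (T : Type) (B : nat -> set T) (n : nat)
    (x : T) : R :=
  if n is n'.+1 then (2 * \1_(B 0%N) x + cantor_sum R (fun i => B i.+1) n' x) / 3
  else 0.

Section cantor_code.
Context (R : realType) d (T : measurableType d).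
Implicit Types (B : nat -> set T) (x : T) (y : R).

Lemma cantor_sum_itv B n x : 0 <= cantor_sum R B n x <= 1.
Proof.
elim: n B => [|n IH] B /=; first by rewrite lexx ler01.
have /andP[h0 h1] := IH (fun i => B i.+1).
rewrite indicE; case: (_ \in _) => /=; apply/andP; split; lra.
Qed.

Lemma nondecreasing_cantor_sum B x :
  nondecreasing_seq (fun n => cantor_sum R B n x).
Proof.
apply/nondecreasing_seqP => n; elim: n B => [|n IH] B /=.
  by rewrite indicE; case: (_ \in _) => /=; lra.
by have /= := IH (fun i => B i.+1); rewrite ler_pM2r// lerD2l.
Qed.

Lemma measurable_cantor_sum B n : (forall i, measurable (B i)) ->
  measurable_fun setT (cantor_sum R B n : T -> R).
Proof.
elim: n B => [|n IH] B mB /=; first exact: measurable_cst.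
apply: measurable_funM => //; apply: measurable_funD; last exact: IH.
by apply: measurable_funM => //; exact: measurable_indic.
Qed.

Definition cantor_value B x : R := limn (fun n => cantor_sum R B n x).

Lemma cvg_cantor_sum B x : cantor_sum R B n x @[n --> \oo] --> cantor_value B x.
Proof.
apply: nondecreasing_is_cvgn; first exact: nondecreasing_cantor_sum.
by exists 1 => _ [n _ <-]; have /andP[] := cantor_sum_itv B n x.
Qed.

Lemma cantor_value_itv B x : 0 <= cantor_value B x <= 1.
Proof.
have c := @cvg_cantor_sum B x.
by apply/andP; split; [apply: limr_ge; first exact: cvgP c
                      |apply: limr_le; first exact: cvgP c];
  near=> n; have /andP[] := cantor_sum_itv B n x.
Unshelve. all: by end_near. Qed.

Lemma measurable_cantor_value B : (forall i, measurable (B i)) ->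
  measurable_fun setT (cantor_value B : T -> R).
Proof.
move=> mB; apply: (@measurable_fun_cvg _ _ _ _ (cantor_sum R B)) => [n|x _].
  exact: measurable_cantor_sum.
exact: cvg_cantor_sum.
Qed.

Lemma cantor_value_shift B x :
  cantor_value B x = (2 * \1_(B 0%N) x + cantor_value (fun i => B i.+1) x) / 3.
Proof.
have c := @cvg_cantor_sum B x; rewrite -cvg_shiftS /= in c.
apply: (cvg_unique _ c) => //.
apply: cvgM; last exact: cvg_cst.
by apply: cvgD; [exact: cvg_cst|exact: cvg_cantor_sum].
Qed.

(** Removes the leading ternary digit. A code whose first digit is absent is at most 1/3 and one
    whose first digit is present is at least 2/3, so the threshold 1/2 separates them. *)
Definition cantor_shift y : R := 3 * y - 2 * \1_(`[1 / 2, +oo[%classic) y.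

Definition cantor_digit n : set R := [set y | 1 / 2 <= iter n cantor_shift y].

Lemma cantor_value_ge B x : (1 / 2 <= cantor_value B x) <-> B 0%N x.
Proof.
have /andP[h0 h1] := cantor_value_itv (fun i => B i.+1) x.
rewrite cantor_value_shift indicE; split.
  by have [/set_mem//|_ /=] := boolP (x \in B 0%N); lra.
by move=> /mem_set ->/=; lra.
Qed.

Lemma cantor_shift_value B x :
  cantor_shift (cantor_value B x) = cantor_value (fun i => B i.+1) x.
Proof.
rewrite /cantor_shift !indicE.
have -> : (cantor_value B x \in `[1 / 2, +oo[%classic) = (x \in B 0%N).
  apply/idP/idP => /set_mem; rewrite /= ?in_itv /= ?andbT => H; apply/mem_set.
    exact/cantor_value_ge.
  by rewrite /= in_itv /= andbT; exact/cantor_value_ge.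
by rewrite cantor_value_shift indicE; field.
Qed.

Lemma cantor_digit_value B n x : cantor_digit n (cantor_value B x) <-> B n x.
Proof.
rewrite /cantor_digit /=; elim: n B => [|n IH] B; first exact: cantor_value_ge.
by rewrite iterSr cantor_shift_value; exact: IH.
Qed.

Lemma measurable_cantor_digit n :
  measurable (cantor_digit n : set (R)).
Proof.
have m : measurable_fun setT (cantor_shift : R -> R).
  apply: measurable_funB; first exact: measurable_funM.
  by apply: measurable_funM => //; exact: measurable_indic.
have mi : measurable_fun setT
    (iter n cantor_shift : R -> R).
  elim: n => [|n IH]; first exact: measurable_id.
  exact: (measurableT_comp m IH).
have -> : cantor_digit n = setT `&` (iter n cantor_shift) @^-1` `[1 / 2, +oo[.
  rewrite setTI; apply/seteqP.
  by split=> y; rewrite /cantor_digit /= in_itv /= andbT.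
exact: mi.
Qed.

End cantor_code.

(** If a real variable has the law of [s x], then [g] sends it to a variable with the law of [x],
    whatever [g] does off the image of [s]. The bounds on [s] serve the quantile function, which
    takes values in the unit interval. *)
Definition borel_retract (R : realType) (T : ptopologicalType) : Prop :=
  exists (s : borel T -> R) (g : R -> borel T),
  [/\ measurable_fun setT s, measurable_fun setT g,
      (forall x, g (s x) = x) & forall x, 0 <= s x <= 1].

Lemma polish_borel_retract (R : realType) (T : ptopologicalType) :
  polish R T -> borel_retract R T.
Proof.
(* [s x] codes the bits [D (d m) x < 1 / k.+1]; [g y] is the unique point which
   is compatible with the bits of [y], when there is one. *)
move=> /polish_metric[D [d [D0 Dsym Dtri [oD Dn dd Dcomp]]]].
pose pk n := odflt (0, 0)%N (unpickle n) : nat * nat.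
pose c n := d (pk n).1; pose r n : R := (pk n).2.+1%:R^-1.
pose B n : set (borel T) := [set x | D (c n) x < r n].
pose b n : set R := @cantor_digit R n.
have mb n : measurable (b n) by exact: measurable_cantor_digit.
have mB n : measurable (B n) by apply: borel_open; exact: oD.
(* Bit [n] of [y] selects the ball of centre [c n] and radius [r n]. The two conditions ask for
   selected balls of every radius [1 / k.+1] and for centres as close as those of intersecting
   balls; they make the centres Cauchy, yet involve only countably many bits, so [good] is Borel. *)
pose good : set R := [set y |
  (forall k, exists2 n, (pk n).2 = k & b n y) /\
  (forall n m, b n y -> b m y -> D (c n) (c m) <= r n + r m)].
pose lim y : set (borel T) := [set x | forall n, b n y -> D x (c n) <= r n].
have half (e : R) : 0 < e -> 0 < e / 2 by move=> ?; rewrite divr_gt0.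
have rlt (e : R) : 0 < e -> exists k, forall n, (k <= (pk n).2)%N -> r n < e.
  move=> e0; exists (Num.truncn e^-1) => n kn.
  rewrite invf_plt ?posrE//; apply: (lt_le_trans (truncnS_gt _)).
  by rewrite ler_nat.
have good_lim y : good y -> exists x, lim y x.
  move=> [/(_ _)/cid2-/all_sig2[N Nk bN] gD].
  have [|x ux] := Dcomp (fun k => c (N k)).
    move=> e e0; have [k ke] := rlt (e / 2) (half _ e0).
    exists k => i j ki kj; apply: (le_lt_trans (gD _ _ (bN i) (bN j))).
    by rewrite (splitr e) ltrD//; apply: ke; rewrite Nk.
  exists x => n bn; apply/ler_addgt0Pr => e e0.
  have [k ke] := rlt (e / 2) (half _ e0).
  have [k' ke'] := ux (e / 2) (half _ e0).
  pose i := maxn k k'.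
  apply: (le_trans (Dtri _ (c (N i)) _)).
  have h1 : r (N i) < e / 2 by apply: ke; rewrite Nk leq_maxl.
  have h2 : D x (c (N i)) < e / 2 by rewrite Dsym ke'// leq_maxr.
  have h3 := gD _ _ (bN i) bn; lra.
(* The limit is within [2 * r n] of a point outside [O] for arbitrarily small [r n], and the
   complement of [O] is closed. *)
have good_closed y (O : set T) x : open O -> good y -> lim y x ->
    (forall n, b n y -> exists2 z, ~ O z & D z (c n) <= r n) -> ~ O x.
  move=> oO [gk _] yx Ob Ox; have [e e0 He] := Dn _ _ oO Ox.
  have [k ke] := rlt (e / 2) (half _ e0).
  have [n nk bn] := gk k; have [z Oz zn] := Ob _ bn; apply/Oz/He.
  apply: (le_lt_trans (Dtri _ (c n) _)); rewrite (Dsym _ z).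
  have h1 : r n < e / 2 by apply: ke; rewrite nk.
  have h2 := yx _ bn; lra.
have lim_uniq y x x' : good y -> lim y x -> lim y x' -> x = x'.
  move=> [gk _] yx yx'; apply/D0/eqP; rewrite eq_le; apply/andP; split; last first.
    have := Dtri x x' x; rewrite (Dsym x') (D0 x x).2// => h; lra.
  apply/ler_addgt0Pr => e e0; rewrite add0r.
  have [k ke] := rlt (e / 2) (half _ e0).
  have [n nk bn] := gk k; apply: (le_trans (Dtri _ (c n) _)); rewrite (Dsym _ x').
  have h1 : r n < e / 2 by apply: ke; rewrite nk.
  have h2 := yx _ bn; have h3 := yx' _ bn; lra.
have mgood : measurable good.
  have -> : good = (\bigcap_k \bigcup_n
        (if (pk n).2 == k then b n else set0)) `&`
      \bigcap_n \bigcap_m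
        (if D (c n) (c m) <= r n + r m then setT else ~` b n `|` ~` b m).
    apply/seteqP; split=> y [h1 h2]; split.
    - by move=> k _; have [n nk bn] := h1 k; exists n => //; rewrite nk eqxx.
    - move=> n _ m _; case: ifPn => // /negP nm.
      by apply/not_andP => -[? ?]; exact/nm/h2.
    - by move=> k; have [n _] := h1 k I; case: eqP => // nk bn; exists n.
    - move=> n m bn bm; have := h2 n I m I; case: ifPn => // _ [].
        by move=> /(_ bn).
      by move=> /(_ bm).
  apply: measurableI.
    apply: bigcapT_measurable => k; apply: bigcupT_measurable => n.
    by case: ifPn.
  apply: bigcapT_measurable => n; apply: bigcapT_measurable => m.
  by case: ifPn => // _; apply: measurableU; exact: measurableC.
pose g y : borel T := if `[<good y>] then xget point (lim y) else point.
have glim y : good y -> lim y (g y).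
  by move=> gy; rewrite /g asboolT//; apply: xgetPex; exact: good_lim.
exists (cantor_value R B), g; split.
- exact: measurable_cantor_value.
- apply: borel_measurable_fun => O oO.
  (* For a good [y], [g y] lies outside [O] exactly when every selected closed ball meets the
     complement of [O]. This expresses the preimage of [O] through the bits of [y]; the codes that
     are not good all go to [point]. *)
  pose H := \bigcap_n
    (if `[< exists2 z, ~ O z & D z (c n) <= r n >] then setT else ~` b n).
  have mH : measurable H.
    by apply: bigcapT_measurable => n; case: ifPn => // _; exact: measurableC.
  have -> : g @^-1` O = (good `&` ~` H) `|`
      (~` good `&` (if `[< O point >] then setT else set0)).
    apply/seteqP; split=> y /=.
      have [gy Oy|gy] := pselect (good y).
        left; split=> // Hy; apply: (good_closed y O (g y)) => //; first exact: glim.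
        by move=> n bn; have := Hy n I; case: asboolP.
      by rewrite /g asboolF// => Op; right; split=> //; rewrite asboolT.
    move=> [[gy nH]|[ngy]]; last by rewrite /g (asboolF ngy); case: asboolP.
    apply: contrapT => Ogy; apply: nH => n _; case: asboolP => // nz bn.
    by apply: nz; exists (g y) => //; exact: glim.
  apply: measurableU; first by apply: measurableI => //; exact: measurableC.
  by apply: measurableI; [exact: measurableC|case: ifPn].
- have bB n x : b n (cantor_value R B x) <-> B n x by exact: cantor_digit_value.
  move=> x; have gx : good (cantor_value R B x).
    split=> [k|n m /bB/= xn /bB/= xm].
      have [|m xm] := dd x (k.+1%:R^-1); first by [].
      exists (pickle (m, k)); first by rewrite /pk pickleK.
      by apply/bB; rewrite /B /r /c /pk /= pickleK /= Dsym.
    by apply: (le_trans (Dtri _ x _)); rewrite (Dsym x) lerD// ltW.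
  apply: (lim_uniq _ _ _ gx (glim _ gx)) => n /bB/=.
  by rewrite Dsym => /ltW.
- exact: cantor_value_itv.
Qed.

(** * Adjoining the cemetery point *)

Lemma add_isolated_openE (T : topologicalType) (A : set (add_isolated T)) :
  open A = open (Some @^-1` A : set T).
Proof. by []. Qed.

Lemma add_isolated_countable_base (T : topologicalType) (B : nat -> set T) :
  countable_base B -> exists B', @countable_base (add_isolated T) B'.
Proof.
move=> [oB HB]; pose B' n : set (add_isolated T) :=
  if n is n'.+1 then Some @` B n' else [set None].
have SomeK (A : set T) : Some @^-1` (Some @` A) = A.
  by apply/seteqP; split=> x /=; [move=> [y Ay [<-]]|exists x].
exists B'; split=> [[|n]|U [x|] oU Ux].
- rewrite add_isolated_openE (_ : _ @^-1` _ = set0); first exact: open0.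
  by apply/seteqP; split.
- by rewrite add_isolated_openE SomeK.
- have [n Bx BU] := HB (Some @^-1` U) x oU Ux.
  by exists n.+1; [exists x|move=> _ [y /BU Uy <-]].
- by exists 0%N => // _ ->.
Qed.

Lemma measurable_isolated (T : ptopologicalType) :
  measurable ([set None] : set (borel (add_isolated T))).
Proof.
apply: borel_open; rewrite add_isolated_openE (_ : _ @^-1` _ = set0).
  exact: open0.
by apply/seteqP; split.
Qed.

(** Halving the codes of [T] confines them to [[0, 1/2]], which frees the value 1 for the isolated
    point. *)
Lemma add_isolated_borel_retract (R : realType) (T : ptopologicalType) :
  borel_retract R T -> borel_retract R (add_isolated T).
Proof.
move=> [s [g [ms mg gs s01]]].
have mN := @measurable_isolated T.
pose rho (x : borel (add_isolated T)) : borel T := odflt point x.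
have mrho : measurable_fun setT rho.
  by apply: borel_measurable_fun => U oU; exact: borel_open.
pose s' (x : borel (add_isolated T)) : R :=
  if x is Some a then s a / 2 else 1.
pose g' (y : R) : borel (add_isolated T) :=
  if y == 1 then None else Some (g (2 * y)).
exists s', g'; split.
- move=> _ Y mY.
  have -> : setT `&` s' @^-1` Y =
      (~` [set None] `&` rho @^-1` ((fun x => s x / 2) @^-1` Y)) `|`
      ([set None] `&` (if 1 \in Y then setT else set0)).
    rewrite setTI; apply/seteqP; split=> [[x|]|[x|]] /=.
    + by left.
    + by move=> Y1; right; rewrite mem_set.
    + by move=> [[]//|[]].
    + by move=> [[]//|[_]]; case: ifPn => // /set_mem.
  have ms2 : measurable_fun setT (fun x => s x / 2) by exact: measurable_funM.
  apply: measurableU; first apply: measurableI; first exact: measurableC.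
    rewrite -[_ @^-1` _]setTI; apply: mrho => //.
    by rewrite -[_ @^-1` _]setTI; exact: ms2.
  by apply: measurableI => //; case: ifPn.
- apply: borel_measurable_fun => U oU.
  have -> : g' @^-1` U =
      ([set 1] `&` (if None \in U then setT else set0)) `|`
      (~` [set 1] `&` (fun y : R => g (2 * y)) @^-1` (Some @^-1` U)).
    apply/seteqP; split=> y /=; rewrite /g'; case: eqP => y1.
    + by move=> UN; left; rewrite mem_set.
    + by right.
    + by move=> [[_]|[]//]; case: ifPn => // /set_mem.
    + by move=> [[]//|[]].
  have mg2 : measurable_fun setT (fun y : R => g (2 * y)).
    by apply: (measurableT_comp mg); exact: measurable_funM.
  apply: measurableU; first by apply: measurableI => //; case: ifPn.
  apply: measurableI; first exact: measurableC.
  by rewrite -[_ @^-1` _]setTI; apply: mg2 => //; exact: borel_open.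
- move=> [x|]; rewrite /g' /s' ?eqxx//.
  have /andP[s0 s1] := s01 x.
  rewrite lt_eqF; last by lra.
  by rewrite mulrC divfK// gs.
- move=> [x|] /=; rewrite ?lexx ?ler01//.
  by have /andP[s0 s1] := s01 x; apply/andP; split; lra.
Qed.

Section hat.
Context (R : realType) (K : nat) (X : 'I_K.+1 -> ptopologicalType).
Hypothesis hX : forall k, polish R (X k).

Lemma hat_countable_base k : exists B, @countable_base (hat X k) B.
Proof.
have [B HB] := polish_countable_base (hX k); rewrite /hat.
by case: ifP => _; [exact: (add_isolated_countable_base HB)|exists B].
Qed.

Lemma hat_borel_retract k : borel_retract R (hat X k).
Proof.
have := polish_borel_retract (hX k); rewrite /hat.
by case: ifP => _ //; exact: add_isolated_borel_retract.
Qed.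

End hat.

(** Measurable coordinates control rectangles only, while the target carries all Borel sets of the
    product topology. Countable bases close the gap: an open set is a countable union of basic
    boxes. *)
Lemma measurable_borel_pair d (W : measurableType d) (S T : ptopologicalType)
    (BS : nat -> set S) (BT : nat -> set T) (f : W -> borel S) (g : W -> borel T) :
  countable_base BS -> countable_base BT ->
  measurable_fun setT f -> measurable_fun setT g ->
  measurable_fun setT (fun w => (f w, g w) : borel (S * T)%type).
Proof.
move=> [oS HS] [oT HT] mf mg; apply: borel_measurable_fun => U oU.
have -> : (fun w => (f w, g w)) @^-1` U = \bigcup_n \bigcup_m
    (if `[< BS n `*` BT m `<=` U >] then f @^-1` BS n `&` g @^-1` BT m else set0).
  apply/seteqP; split=> w /=.
    move=> Uw; have : nbhs ((f w : S), (g w : T)) U by exact: open_nbhs_nbhs.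
    move=> [[V1 V2] /= []].
    rewrite !nbhsE => -[V1' [oV1 V1w] V1'V] [V2' [oV2 V2w] V2'V] VU.
    have [n nw nV] := HS _ _ oV1 V1w; have [m mw mV] := HT _ _ oV2 V2w.
    exists n => //; exists m => //; rewrite asboolT// => -[x y] [/= xn ym].
    by apply: VU; split; [exact/V1'V/nV|exact/V2'V/mV].
  by move=> [n _ [m _]]; case: asboolP => // nmU [? ?]; exact: nmU.
apply: bigcupT_measurable => n; apply: bigcupT_measurable => m.
case: ifPn => // _; apply: measurableI.
  by rewrite -[_ @^-1` _]setTI; apply: mf => //; exact: borel_open.
by rewrite -[_ @^-1` _]setTI; apply: mg => //; exact: borel_open.
Qed.

Lemma continuous_borel_measurable (S T : ptopologicalType) (f : S -> T) :
  continuous f -> measurable_fun setT (f : borel S -> borel T).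
Proof.
move=> /continuousP cf; apply: borel_measurable_fun => U oU.
by apply: borel_open; exact: cf.
Qed.

Lemma borel_fst_measurable (S T : ptopologicalType) :
  measurable_fun setT (fst : borel (S * T)%type -> borel S).
Proof. by apply: continuous_borel_measurable => x; exact: cvg_fst. Qed.

Lemma borel_snd_measurable (S T : ptopologicalType) :
  measurable_fun setT (snd : borel (S * T)%type -> borel T).
Proof. by apply: continuous_borel_measurable => x; exact: cvg_snd. Qed.

(** * Borel sets of products *)

(** Boxes that restrict every coordinate generate a filter finer than the neighbourhoods of [x]. It
    converges to [x] because convergence for a supremum of topologies is checked one coordinate at a
    time. *)
Lemma prod_topology_box (I : eqType) (T : I -> topologicalType)
    (U : set (prod_topology T)) (x : prod_topology T) : open U -> U x ->
  exists2 V : forall i, set (T i), (forall i, open (V i) /\ V i (x i)) &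
    forall y : prod_topology T, (forall i, V i (y i)) -> U y.
Proof.
move=> oU Ux.
pose F : set_system (prod_topology T) :=
  filter_from [set V : forall i, set (T i) | forall i, open (V i) /\ V i (x i)]
    (fun V => [set y : prod_topology T | forall i, V i (y i)]).
have FF : Filter F.
  apply: filter_from_filter.
    by exists (fun=> setT) => i; split => //; exact: openT.
  move=> V W HV HW; exists (fun i => V i `&` W i) => [i|y yVW].
    have [oV Vx] := HV i; have [oW Wx] := HW i.
    by split; [exact: openI|split].
  by split=> i; have [] := yVW i.
suff : F --> x.
  by move=> /(_ U) []; [exact: open_nbhs_nbhs|move=> V HV VU; exists V].
apply/cvg_sup => i A /= [_ [[B oB <-] Bx BA]].
pose V := dfwith (fun=> setT) i B : forall j, set (T j).
exists V => [j|y yV].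
  rewrite /V; case: dfwithP => [|k ik]; first by split.
  by split => //; exact: openT.
by apply: BA; have := yV i; rewrite /V dfwithin.
Qed.

Lemma measurable_borel_prod d (W : measurableType d) (n : nat)
    (T : 'I_n -> ptopologicalType) (f : forall i, W -> borel (T i)) :
  (forall i, exists B, @countable_base (T i) B) ->
  (forall i, measurable_fun setT (f i)) ->
  measurable_fun setT (fun w => (fun i => f i w) : borel (prod_topology T)).
Proof.
move=> cB mf; have /all_sig[B HB] := fun i => cid (cB i).
apply: borel_measurable_fun => U oU.
(* The index set being finite, basic boxes are indexed by a countable type of finite functions. *)
pose box (m : {ffun 'I_n -> nat}) : set (prod_topology T) :=
  [set y | forall i, B i (m i) (y i)].
have -> : (fun w => (fun i => f i w)) @^-1` U = \bigcup_m
    (if `[< box m `<=` U >] then \bigcap_i (f i @^-1` B i (m i)) else set0).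
  apply/seteqP; split=> w /=.
    move=> Uw; have [V HV VU] := prod_topology_box oU Uw.
    have /choice[m Hm] : forall i,
        exists m, B i m (f i w) /\ B i m `<=` V i.
      move=> i; have [_ /(_ (V i) (f i w))] := HB i.
      by have [oV Vw] := HV i => /(_ oV Vw)[m ? ?]; exists m.
    exists (finfun m) => //; rewrite asboolT.
      by move=> i _; rewrite /= ffunE; have [] := Hm i.
    move=> y ym; apply: VU => i; have [_] := Hm i; apply.
    by have := ym i; rewrite ffunE.
  by move=> [m _]; case: asboolP => // mU mw; apply: mU => i; exact: mw.
apply: countable_bigcupT_measurable => [|m]; first exact: countableP.
case: ifPn => // _.
apply: fin_bigcap_measurable => // i _.
rewrite -[_ @^-1` _]setTI; apply: mf => //; apply: borel_open.
by have [] := HB i.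
Qed.

Lemma borel_proj_measurable (n : nat) (T : 'I_n -> ptopologicalType) i :
  measurable_fun setT
    (fun y : borel (prod_topology T) => y i : borel (T i)).
Proof.
apply: (@continuous_borel_measurable (prod_topology T) (T i)).
exact: (@proj_continuous _ T i).
Qed.

Lemma exists_distribution d d' (T : measurableType d) (T' : measurableType d')
    (R : realType) (P : probability T R) (f : T -> T') :
  measurable_fun setT f ->
  exists Q : probability T' R, forall A, Q A = P (f @^-1` A).
Proof.
move=> mf.
pose X : {mfun T >-> T'} := HB.pack f (isMeasurableFun.Build _ _ _ _ f mf).
by exists (distribution P X).
Qed.

Lemma borel_pair_unique (R : realType) (S T : ptopologicalType)
    (BS : nat -> set S) (BT : nat -> set T)
    (m1 m2 : probability (borel (S * T)%type) R) :
  countable_base BS -> countable_base BT ->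
  (forall (A : set (borel S)) (B : set (borel T)), measurable A -> measurable B ->
    m1 (A `*` B) = m2 (A `*` B)) ->
  forall C, measurable C -> m1 C = m2 C.
Proof.
move=> HS HT H.
have mX (A : set (borel S)) (B : set (borel T)) : measurable A -> measurable B ->
    measurable (A `*` B : set (borel (S * T)%type)).
  move=> mA mB; rewrite -[_ `*` _]/(fst @^-1` A `&` snd @^-1` B).
  apply: measurableI.
    by rewrite -[_ @^-1` _]setTI; apply: borel_fst_measurable.
  by rewrite -[_ @^-1` _]setTI; apply: borel_snd_measurable.
pose G : set (set (borel (S * T)%type)) :=
  [set A `*` B | A in @measurable _ (borel S) & B in @measurable _ (borel T)].
apply: (@measure_unique _ R (borel (S * T)%type) G (fun=> setT)) => //.
(* The Borel sets of the product are the product sigma-algebra: the identity is measurable one way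
   by countable bases, the other way by continuity of the projections. *)
- transitivity (@measurable _ (borel S * borel T)%type); last first.
    exact: (@measurable_prod_measurableType _ _ (borel S) (borel T)).
  apply/seteqP; split=> C mC.
    have := measurable_borel_pair HS HT
      (@measurable_fst _ _ (borel S) (borel T))
      (@measurable_snd _ _ (borel S) (borel T)).
    move=> /(_ measurableT _ mC); rewrite setTI.
    by rewrite (_ : _ @^-1` C = C)//; apply/seteqP; split=> -[].
  have := measurable_fun_pair (@borel_fst_measurable S T)
    (@borel_snd_measurable S T).
  move=> /(_ measurableT _ mC); rewrite setTI.
  by rewrite (_ : _ @^-1` C = C)//; apply/seteqP; split=> -[].
- move=> _ _ [A1 mA1 [B1 mB1 <-]] [A2 mA2 [B2 mB2 <-]].
  exists (A1 `&` A2); first exact: measurableI.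
  by exists (B1 `&` B2); [exact: measurableI|rewrite setXI].
- by move=> _; exists setT => //; exists setT => //; rewrite setXTT.
- by rewrite bigcup_const//; exists 0%N.
- by move=> _ [A mA [B mB <-]]; exact: H.
- move=> _; rewrite [X in (X < _)%E](_ : _ = 1%E) ?ltry//.
  exact: probability_setT.
Qed.

(** * Conditional quantiles *)

Local Open Scope ereal_scope.

(* The proofs are arguments so that the measure structure can be inferred. *)
Definition law_on d d' (W : measurableType d) (S : measurableType d')
    (R : realType) (pi : probability W R) (D : set W) (u : W -> S)
    (mD : measurable D) (mu : measurable_fun setT u) : set S -> \bar R :=
  fun A => pi (u @^-1` A `&` D).

Section law_on.
Context d d' (W : measurableType d) (S : measurableType d') (R : realType).
Variables (pi : probability W R) (D : set W) (u : W -> S).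
Hypotheses (mD : measurable D) (mu : measurable_fun setT u).

Local Notation law := (law_on pi mD mu).

Let mpre A : measurable A -> measurable (u @^-1` A `&` D).
Proof.
by move=> mA; apply: measurableI => //; rewrite -[_ @^-1` _]setTI; exact: mu.
Qed.

Let law0 : law set0 = 0.
Proof. by rewrite /law_on preimage_set0 set0I measure0. Qed.

Let law_ge0 A : 0 <= law A.
Proof. exact: measure_ge0. Qed.

Let law_sigma_additive : semi_sigma_additive law.
Proof.
move=> F mF tF mUF; rewrite /law_on preimage_bigcup setI_bigcupl.
apply: measure_semi_sigma_additive => [n||].
- exact: mpre.
- apply/trivIsetP => i j _ _ ij; rewrite setIACA -preimage_setI.
  by move/trivIsetP : tF => /(_ _ _ I I ij) ->; rewrite preimage_set0 set0I.
- by rewrite -setI_bigcupl -preimage_bigcup; exact: mpre.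
Qed.

HB.instance Definition _ := isMeasure.Build _ _ _ law
  law0 law_ge0 law_sigma_additive.

Let law_fin : fin_num_fun law.
Proof. by move=> A mA; apply: fin_num_measure; exact: mpre. Qed.

HB.instance Definition _ := Measure_isFinite.Build _ _ _ law law_fin.

End law_on.

(** Testing the inequality on the exceptional set itself gives the positive function [f - g] a
    nonpositive integral there, so that set is null. *)
Lemma ae_le_of_integral d (T : measurableType d) (R : realType)
    (mu : {measure set T -> \bar R}) (f g : T -> \bar R) :
  mu.-integrable setT f -> mu.-integrable setT g ->
  (forall x, f x \is a fin_num) -> (forall x, g x \is a fin_num) ->
  (forall A, measurable A -> \int[mu]_(x in A) f x <= \int[mu]_(x in A) g x) ->
  mu [set x | g x < f x] = 0.
Proof.
move=> fi gi ff gf fg; pose A := [set x | g x < f x].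
have mA : measurable A.
  rewrite -[A]setTI; apply: measurable_lte => //.
    exact: measurable_int gi.
  exact: measurable_int fi.
have fiA : mu.-integrable A f by exact: integrableS fi.
have giA : mu.-integrable A g by exact: integrableS gi.
have : \int[mu]_(x in A) `|f x - g x| = 0.
  rewrite (eq_integral (fun x => f x - g x)); last first.
    by move=> x /set_mem /ltW gf'; apply: gee0_abs; rewrite sube_ge0 ?gf.
  apply/eqP; rewrite eq_le; apply/andP; split.
    rewrite integralB// leeBlDr.
      by rewrite add0e; apply: fg.
    exact: integrable_fin_num.
  by apply: integral_ge0 => x Ax; rewrite sube_ge0 ?gf// ltW.
move/ae_eq_integral_abs => /(_ mA).
have mfg : measurable_fun A (fun x => f x - g x).
  by apply: emeasurable_funB; [exact: measurable_int fiA|exact: measurable_int giA].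
move=> /(_ mfg) [N [mN N0 AN]].
apply/eqP; rewrite -measure_le0 -N0; apply: le_measure; rewrite ?inE//.
move=> x Ax; apply: AN => /= /(_ Ax) /eqP; rewrite sube_eq ?ff// ?gf//.
  by rewrite add0e => /eqP fgx; move: Ax; rewrite /A /= fgx ltxx.
Qed.

(** [F q x] is a version of the conditional probability of [v < q] given [u = x]. For each threshold
    or pair of thresholds the bound by 1 or the monotonicity of the densities fails only on a null
    set, and rational thresholds produce countably many such sets. *)
Lemma conditional_cdf d d' (W : measurableType d) (S : measurableType d')
    (R : realType) (pi : probability W R) (u : W -> S) (v : W -> R)
    (nu : probability S R) :
  measurable_fun setT u -> measurable_fun setT v ->
  (forall A, measurable A -> nu A = pi (u @^-1` A)) ->
  exists F : rat -> S -> R, [/\ forall q, measurable_fun setT (F q),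
    forall q x, (0 <= F q x <= 1)%R,
    forall p q x, (p <= q)%R -> (F p x <= F q x)%R &
    forall q A, measurable A -> \int[nu]_(x in A) (F q x)%:E =
      pi (u @^-1` A `&` [set w | (v w < ratr q)%R])].
Proof.
move=> mu mv nuE.
pose D (q : rat) := [set w | (v w < ratr q)%R].
have mD q : measurable (D q).
  rewrite -[D q]setTI.
  rewrite [X in measurable (_ `&` X)](_ : _ = v @^-1` `]-oo, ratr q[%classic).
    exact: mv.
  by apply/seteqP; split=> w; rewrite /D /= in_itv.
have mpre A : measurable A -> measurable (u @^-1` A).
  by move=> mA; rewrite -[_ @^-1` _]setTI; exact: mu.
pose law q : {finite_measure set S -> \bar R} := law_on pi (mD q) mu.
have law_dom q : law q `<< nu.
  apply/null_content_dominatesP => A mA A0; apply/eqP.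
  rewrite -measure_le0 -(etrans (esym (nuE _ mA)) A0).
  change (pi (u @^-1` A `&` D q) <= pi (u @^-1` A)).
  apply: le_measure; rewrite ?inE; [|exact: mpre|exact: subIsetl].
  by apply: measurableI => //; exact: mpre.
pose f q := Radon_Nikodym_SigmaFinite.f (law q) nu.
have f0 q x : 0 <= f q x by exact: Radon_Nikodym_SigmaFinite.f_ge0.
have ffin q x : f q x \is a fin_num by exact: Radon_Nikodym_SigmaFinite.f_fin_num.
have fint q : nu.-integrable setT (f q).
  by exact: Radon_Nikodym_SigmaFinite.f_integrable.
have fE q A : measurable A -> \int[nu]_(x in A) f q x = pi (u @^-1` A `&` D q).
  by move=> mA; rewrite -Radon_Nikodym_SigmaFinite.f_integral.
have mf q : measurable_fun setT (f q) by exact: measurable_int (fint q).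
pose Bm (pq : rat * rat) := if (pq.1 <= pq.2)%R
  then [set x | f pq.2 x < f pq.1 x] else set0.
pose B1 q := [set x | 1 < f q x].
pose N := \bigcup_n oapp Bm set0 (unpickle n) `|`
  \bigcup_n oapp B1 set0 (unpickle n).
have mBm pq : measurable (Bm pq).
  rewrite /Bm; case: ifPn => // _; rewrite -[X in measurable X]setTI.
  exact: measurable_lte.
have mB1 q : measurable (B1 q).
  by rewrite -[B1 q]setTI; apply: measurable_lte => //; exact: measurable_cst.
have mN : measurable N.
  by apply: measurableU; apply: bigcupT_measurable => n;
    case: (unpickle n) => [?|] /=.
have N0 : nu.-negligible N.
  apply: negligibleU.
    apply: negligible_bigcup => n; case: (unpickle n) => [[p q]|] /=; last first.
      exact: negligible_set0.
    apply/negligibleP => //.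
    rewrite /Bm; case: ifPn => /= pq; last exact: measure0.
    apply: ae_le_of_integral => // A mA; rewrite !fE//.
    apply: le_measure; rewrite ?inE; [| |apply: setIS => w /= h].
    - by apply: measurableI => //; exact: mpre.
    - by apply: measurableI => //; exact: mpre.
    - by apply: (lt_le_trans h); rewrite ler_rat.
  apply: negligible_bigcup => n; case: (unpickle n) => [q|] /=; last first.
    exact: negligible_set0.
  apply/negligibleP => //.
  apply: (@ae_le_of_integral _ _ _ nu (f q) (cst 1)) => //.
    exact: finite_measure_integrable_cst.
  move=> A mA; rewrite fE// integral_cst// mul1e.
  rewrite [leRHS](_ : _ = pi (u @^-1` A)); last exact: nuE.
  apply: le_measure; rewrite ?inE; [|exact: mpre|exact: subIsetl].
  by apply: measurableI => //; exact: mpre.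
(* Setting all densities to 0 on the null set [N] keeps the integrals and makes the bounds and the
   monotonicity hold at every point. *)
exists (fun q x => fine (f q x) * \1_(~` N) x)%R; split.
- move=> q; apply: measurable_funM; first exact: measurableT_comp.
  by apply: measurable_indic; exact: measurableC.
- move=> q x; rewrite indicE; case: (boolP (x \in ~` N)) => [|_];
    last by rewrite mulr0 lexx ler01.
  move=> /set_mem Nx; rewrite mulr1 fine_ge0//= -lee_fin fineK// leNgt.
  by apply/negP => fx; apply: Nx; right; exists (pickle q); [exact: I|rewrite pickleK].
- move=> p q x pq; rewrite indicE; case: (boolP (x \in ~` N)) => [|_];
    last by rewrite !mulr0.
  move=> /set_mem Nx; rewrite !mulr1 -lee_fin !fineK// leNgt.
  apply/negP => fx; apply: Nx; left; exists (pickle (p, q)); first exact: I.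
  by rewrite pickleK /= /Bm /= pq.
- move=> q A mA; transitivity (\int[nu]_(x in A) f q x); last by rewrite fE.
  apply: ae_eq_integral => //.
  + apply/measurable_EFinP; apply: measurable_funTS.
    apply: measurable_funM; first exact: measurableT_comp.
    by apply: measurable_indic; exact: measurableC.
  + exact: measurable_funTS.
  + apply: (negligibleS _ N0) => x /= /not_implyP[Ax ne].
    by apply: contrapT => Nx; apply: ne; rewrite indicE mem_set// mulr1 fineK//.
Qed.

Lemma uniform_prob_lt (R : realType) (y : R) : (0 <= y <= 1)%R ->
  uniform_prob (@ltr01 R) [set r | (r < y)%R] = y%:E.
Proof.
move=> /andP[y0 y1]; rewrite /uniform_prob integral_uniform_pdf.
have -> : [set r | (r < y)%R] `&` `[0%R, 1%R] = `[0%R, y[%classic.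
  apply/seteqP; split=> r /=; rewrite !in_itv /=.
    by move=> [ry /andP[-> _]].
  by move=> /andP[-> ry]; split => //; rewrite (ltW (lt_le_trans ry y1)).
rewrite (eq_integral (cst 1)); last first.
  move=> r /set_mem; rewrite /= in_itv /= /uniform_pdf => /andP[-> ry] /=.
  by rewrite (ltW (lt_le_trans ry y1)) subr0 invr1.
rewrite integral_cst//= mul1e lebesgue_measure_itv /= lte_fin.
case: ltP => [_|]; first by rewrite sube0.
by move=> y0'; congr (_%:E); apply/eqP; rewrite eq_le y0.
Qed.

(** The pushforward along the identity only transfers the uniform law from [measurableTypeR R] to
    the structure on [R] used elsewhere. *)
Lemma exists_uniform (R : realType) : exists U : probability R R,
  forall y, (0 <= y <= 1)%R -> U [set r | (r < y)%R] = y%:E.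
Proof.
pose U0 : probability (measurableTypeR R) R := uniform_prob (@ltr01 R).
have mid : measurable_fun setT (id : measurableTypeR R -> R).
  by move=> _ Y mY; rewrite setTI.
have [U UE] := exists_distribution U0 mid.
by exists U => y y01; rewrite UE; exact: uniform_prob_lt.
Qed.

Lemma measure_rat_rays_unique (R : realType)
    (m1 m2 : {finite_measure set R -> \bar R}) :
  (forall a : rat, m1 [set x | (x < ratr a)%R] = m2 [set x | (x < ratr a)%R]) ->
  forall B, measurable B -> m1 B = m2 B.
Proof.
move=> m12.
pose G : set (set R) := [set B | exists a : rat, B = [set x | (x < ratr a)%R]].
apply: (@measure_unique _ R _ G (fun n => [set x | (x < ratr n%:R)%R])) => //.
- apply: etrans (RGenInftyO.measurableE R) _.
  apply/seteqP; split; apply: smallest_sub; try exact: smallest_sigma_algebra.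
    move=> _ [x ->].
    have -> : `]-oo, x[%classic = \bigcup_(a : rat)
        (if (ratr a <= x)%R then [set y | (y < ratr a)%R] else set0).
      apply/seteqP; split=> y /=; rewrite in_itv /=.
        move=> /rat_in_itvoo[a]; rewrite in_itv /= => /andP[ya ax].
        by exists a => //; rewrite ltW.
      by move=> [a _]; case: ifPn => // ax ya; exact: lt_le_trans ax.
    change (measurable (\bigcup_(a : rat) (if (ratr a <= x)%R
      then [set y | (y < ratr a)%R] else set0) : set (g_sigma_algebraType G))).
    apply: countable_bigcupT_measurable => [|a]; first exact: countableP.
    by case: ifPn => // _; apply: sub_sigma_algebra; exists a.
  move=> _ [a ->]; apply: sub_sigma_algebra; exists (ratr a).
  by apply/seteqP; split=> y; rewrite /= in_itv.
- move=> _ _ [a ->] [b ->]; exists (Num.min a b).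
  apply/seteqP; split=> y /=.
    by move=> [ya yb]; rewrite minElt; case: ifP.
  case: (ltP a b) => ab ya; rewrite ?(minElt, ab) in ya.
    by split=> //; apply: (lt_trans ya); rewrite ltr_rat.
  by split=> //; apply: (lt_le_trans ya); rewrite ler_rat.
- by move=> n; exists n%:R.
- apply/seteqP; split=> // x _; exists (Num.truncn x).+1 => //=.
  by rewrite ratr_nat truncnS_gt.
- by move=> _ [a ->]; exact: m12.
- move=> n; rewrite -ge0_fin_numE//; apply: fin_num_measure.
  rewrite (_ : [set x | _] = `]-oo, ratr n%:R[%classic)//.
Qed.

(** [nu] is known to agree with the pushforward on measurable sets only, which is enough for
    integrals; [Q] is the intermediary that equals the pushforward as a function on all sets. *)
Lemma integral_law d d' (W : measurableType d) (S : measurableType d')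
    (R : realType) (P : probability W R) (nu : probability S R) (u : W -> S)
    (A : set S) (f : S -> \bar R) :
  measurable_fun setT u ->
  (forall B, measurable B -> nu B = P (u @^-1` B)) ->
  measurable A -> measurable_fun A f -> (forall x, 0 <= f x) ->
  \int[nu]_(x in A) f x = \int[P]_(w in u @^-1` A) f (u w).
Proof.
move=> mu nuE mA mf f0; have [Q QE] := exists_distribution P mu.
transitivity (\int[Q]_(x in A) f x).
  apply: eq_measure_integral => B mB _.
  exact: etrans (nuE _ mB) (esym (QE _)).
rewrite (_ : (Q : set S -> \bar R) = pushforward P u); last first.
  by apply/funext => B; exact: QE.
by rewrite ge0_integral_pushforward.
Qed.

(** * Realising a conditional law by an independent uniform variable *)

Section noise_outsourcing.
Context d d' (W : measurableType d) (S : measurableType d') (R : realType).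
Variables (pi : probability W R) (u : W -> S) (v : W -> R).
Hypotheses (mu : measurable_fun setT u) (mv : measurable_fun setT v).
Variable U : probability R R.
Hypothesis UE : forall y, (0 <= y <= 1)%R -> U [set r | (r < y)%R] = y%:E.
Hypothesis v01 : forall w, (0 <= v w <= 1)%R.

(** A uniform [r] satisfies [r < F q x] with probability [F q x], and [h (x, r) < a] holds for
    [a <= 1] exactly when [r < F q x] for some rational [0 <= q < a]. Choosing [h] before the space
    [O] and the variable [xi] lets it extend any chain already constructed, as soon as [xi] has the
    law of [u]. *)
Lemma noise_outsourcing : exists2 h : S * R -> R, measurable_fun setT h &
  forall d0 (O : measurableType d0) (P : probability O R) (xi : O -> S),
    measurable_fun setT xi ->
    (forall A, measurable A -> P (xi @^-1` A) = pi (u @^-1` A)) ->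
    forall A B, measurable A -> measurable B ->
      (P \x U) [set w | A (xi w.1) /\ B (h (xi w.1, w.2))] =
      pi (u @^-1` A `&` v @^-1` B).
Proof.
have [nu nuE] := exists_distribution pi mu.
have [F [mF F01 Fmono FE]] := conditional_cdf mu mv (fun A _ => nuE A).
(* The infimum of this set is the generalized inverse of [q |-> F q x] at level [r]. The element 1
   keeps it nonempty and [0 <= q] bounds it below; neither disturbs the law, as [v] takes its values
   in [[0, 1]]. *)
pose E (z : S * R) := [set y : R | y = 1%R \/
  exists q : rat, [/\ (0 <= q)%R, y = ratr q & (z.2 < F q z.1)%R]].
have E1 z : E z !=set0 by exists 1%R; left.
have Elb z : has_lbound (E z).
  by exists 0%R => y [->|[q [q0 -> _]]]; rewrite ?ler01// ler0q.
pose h z := inf (E z).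
have hlt z (a : R) : (h z < a)%R <->
    (1 < a)%R \/ exists q : rat, [/\ (0 <= q)%R, (ratr q < a)%R & (z.2 < F q z.1)%R].
  split=> [/(inf_lt (E1 z))[y [->|[q [q0 -> zq]]] ya]|].
  - by left.
  - by right; exists q.
  move=> [a1|[q [q0 qa zq]]].
    by apply: le_lt_trans a1; apply: ge_inf => //; left.
  by apply: le_lt_trans qa; apply: ge_inf => //; right; exists q.
pose G q := [set z : S * R | (z.2 < F q z.1)%R].
have mG q : measurable (G q).
  rewrite -[G q]setTI.
  rewrite [X in measurable (_ `&` X)](_ : _ =
    (fun z : S * R => (z.2 < F q z.1)%R) @^-1` [set true]).
    by apply: measurable_fun_ltr => //; apply: measurableT_comp.
  by apply/seteqP; split=> z.
have mh : measurable_fun setT h.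
  apply: (measurability _ (RGenInftyO.measurableE R)) => //.
  move=> _ [_ [a ->] <-]; rewrite setTI.
  have -> : h @^-1` `]-oo, a[ = (if (1 < a)%R then setT else set0) `|`
      \bigcup_(q : rat) (if (0 <= q)%R && (ratr q < a)%R then G q else set0).
    apply/seteqP; split=> z /=; rewrite in_itv /=.
      move=> /hlt[->|[q [q0 qa zq]]]; first by left.
      by right; exists q => //; rewrite q0 qa.
    move=> [|[q _]]; case: ifPn => //; first by move=> a1 _; apply/hlt; left.
    by move=> /andP[q0 qa] zq; apply/hlt; right; exists q.
  apply: measurableU; first by case: ifPn.
  apply: countable_bigcupT_measurable => [|q]; first exact: countableP.
  by case: ifPn.
exists h => // d0 O P xi mxi xiE A B mA mB.
pose PU : probability (O * R)%type R := (P \x U)%E.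
pose A' := [set w : O * R | A (xi w.1)].
have mpre dX (X : measurableType dX) dY (Y : measurableType dY) (k : X -> Y) C :
    measurable_fun setT k -> measurable C -> measurable (k @^-1` C).
  by move=> mk mC; rewrite -[X in measurable X]setTI; exact: mk.
have mxi1 : measurable_fun setT (fun w : O * R => xi w.1).
  exact: measurableT_comp.
have mA' : measurable A' by exact: (mpre _ _ _ _ _ _ mxi1 mA).
have mAu : measurable (u @^-1` A) by exact: mpre.
have mxi2 : measurable_fun setT (fun w : O * R => (xi w.1, w.2)).
  by apply: measurable_fun_pair => //; exact: measurable_snd.
have mhxi : measurable_fun setT (fun w : O * R => h (xi w.1, w.2)).
  exact: (measurableT_comp mh mxi2).
have mGxi q : measurable [set w : O * R | (w.2 < F q (xi w.1))%R].
  exact: (mpre _ _ _ _ _ _ mxi2 (mG q)).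
have PUA : PU A' = pi (u @^-1` A).
  rewrite (_ : A' = xi @^-1` A `*` setT); last by apply/seteqP; split=> w // [].
  apply: etrans (product_measure1E _ _ (mpre _ _ _ _ _ _ mxi mA) measurableT) _.
  by rewrite -[RHS]mule1 -xiE//; congr (_ * _); exact: probability_setT.
(* Over a point [x] with [xi x] in [A] the section of the event is a ray of uniform mass
   [F q (xi x)]; over the other points it is empty. *)
have PUq q : PU (A' `&` [set w | (w.2 < F q (xi w.1))%R]) =
    pi (u @^-1` A `&` [set w | (v w < ratr q)%R]).
  rewrite -FE// (@integral_law _ _ _ _ _ P nu xi)//; last 3 first.
  - by move=> C mC; rewrite nuE xiE.
  - by apply/measurable_EFinP; apply: measurable_funTS.
  - by move=> x; rewrite lee_fin; have /andP[] := F01 q x.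
  rewrite [RHS]integral_mkcond; apply: eq_integral => x _ /=.
  rewrite patchE; case: ifPn => xA.
    rewrite -UE//; congr (U _).
    apply/seteqP; split=> r /=; rewrite xsectionE /=; first by case.
    by move=> rF; split => //; exact: (set_mem xA).
  rewrite (_ : xsection _ x = set0) ?measure0//.
  apply/seteqP; split=> r //=; rewrite xsectionE /= => -[Ax _].
  by move: xA; rewrite notin_setE.
have PUray (a : rat) : PU (A' `&` [set w | (h (xi w.1, w.2) < ratr a)%R]) =
    pi (u @^-1` A `&` [set w | (v w < ratr a)%R]).
  have [a0|a0] := leP a 0%R.
    have ra0 : (ratr a <= 0 :> R)%R by rewrite lerq0.
    rewrite (_ : _ `&` _ = set0) ?measure0; last first.
      apply/seteqP; split=> // w [_] /hlt[|[q [q0 qa _]]].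
        by rewrite ltNge (le_trans ra0).
      by move: qa; rewrite ltNge (le_trans ra0)// ler0q.
    rewrite (_ : _ `&` _ = set0) ?measure0//.
    apply/seteqP; split=> // w [_ /=].
    by have /andP[v0 _] := v01 w; rewrite ltNge (le_trans ra0).
  have [a1|a1] := ltP 1%R (ratr a : R).
    rewrite (_ : A' `&` _ = A'); last first.
      by apply/setIidPl => w _; apply/hlt; left.
    rewrite (_ : _ `&` _ = u @^-1` A)//.
    apply/setIidPl => w _ /=; apply: le_lt_trans a1.
    by have /andP[] := v01 w.
  (* The event [h < a] is a union over rationals strictly below [a], which need not be the event for
     [F a]. By monotonicity of [F] the nonnegative rationals [s n], increasing to [a] without
     reaching it, exhaust this union, and continuity from below applies to both measures. *)
  pose s (n : nat) : rat := (a * (1 - n.+1%:R^-1))%R.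
  have s0 n : (0 <= s n)%R.
    by apply: mulr_ge0; [exact: ltW|rewrite subr_ge0 invf_le1// ler1n].
  have sa n : (s n < a)%R.
    by rewrite -[ltRHS]mulr1 ltr_pM2l// ltrBlDr ltrDl invr_gt0.
  have smono m n : (m <= n)%N -> (s m <= s n)%R.
    by move=> mn; rewrite ler_pM2l// lerB// lef_pV2 ?posrE// ler_nat.
  have scvg (x : R) : (x < ratr a)%R -> exists n, (x < ratr (s n))%R.
    move=> /rat_in_itvoo[b]; rewrite in_itv /= ltr_rat => /andP[xb ba].
    exists (Num.truncn (a / (a - b))%R); apply: (lt_le_trans xb).
    rewrite ler_rat /s mulrBr mulr1 lerBrDr -lerBrDl.
    rewrite ler_pdivrMr// mulrC -ler_pdivrMr ?subr_gt0// ltW//.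
    exact: truncnS_gt.
  have c1 : PU (A' `&` [set w | (w.2 < F (s n) (xi w.1))%R]) @[n --> \oo] -->
      PU (A' `&` [set w | (h (xi w.1, w.2) < ratr a)%R]).
    rewrite (_ : _ `&` [set w | (h _ < _)%R] =
        \bigcup_n (A' `&` [set w | (w.2 < F (s n) (xi w.1))%R])); last first.
      apply/seteqP; split=> w.
        move=> [Aw] /hlt[|[q [q0 qa zq]]]; first by rewrite ltNge a1.
        have [n] := scvg _ qa; rewrite ltr_rat => qn; exists n => //; split => //.
        by apply: (lt_le_trans zq); apply: Fmono; exact: ltW.
      move=> [n _ [Aw zn]]; split => //; apply/hlt; right; exists (s n).
      by rewrite ltr_rat.
    apply: nondecreasing_cvg_mu => [n||m n mn].
    - exact: measurableI.
    - by apply: bigcupT_measurable => n; exact: measurableI.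
    - apply/subsetPset; apply: setIS => w /= zm; apply: (lt_le_trans zm).
      by apply: Fmono; exact: smono.
  have mvr q : measurable [set w | (v w < ratr q)%R].
    rewrite (_ : [set w | _] = v @^-1` `]-oo, ratr q[%classic).
      exact: mpre.
    by apply/seteqP; split=> w; rewrite /= in_itv.
  have c2 : pi (u @^-1` A `&` [set w | (v w < ratr (s n))%R]) @[n --> \oo] -->
      pi (u @^-1` A `&` [set w | (v w < ratr a)%R]).
    rewrite (_ : _ `&` [set w | (_ < ratr a)%R] =
        \bigcup_n (u @^-1` A `&` [set w | (v w < ratr (s n))%R])); last first.
      apply/seteqP; split=> w.
        by move=> [Aw /= /scvg[n vn]]; exists n.
      move=> [n _ [Aw vn]]; split => //=; apply: (lt_trans vn).
      by rewrite ltr_rat.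
    apply: nondecreasing_cvg_mu => [n||m n mn].
    - exact: measurableI.
    - by apply: bigcupT_measurable => n; exact: measurableI.
    - apply/subsetPset; apply: setIS => w /= zm; apply: (lt_le_trans zm).
      by rewrite ler_rat smono.
  have eqs : (fun n => PU (A' `&` [set w | (w.2 < F (s n) (xi w.1))%R])) =
      (fun n => pi (u @^-1` A `&` [set w | (v w < ratr (s n))%R])).
    by apply/funext => n; exact: PUq.
  rewrite eqs in c1.
  exact: (cvg_unique _ c1 c2).
(* For fixed [A] both sides are finite measures in [B], hence determined by their values on rational
   rays. *)
rewrite -[LHS]/(PU (A' `&` (fun w => h (xi w.1, w.2)) @^-1` B)).
rewrite (setIC A') (setIC (u @^-1` A)).
apply: (@measure_rat_rays_unique R (law_on PU mA' mhxi) (law_on pi mAu mv)) => // a.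
rewrite -[LHS]/(PU ((fun w => h (xi w.1, w.2)) @^-1` _ `&` A')).
by rewrite -[RHS]/(pi (v @^-1` _ `&` u @^-1` A)) (setIC _ A') (setIC _ (u @^-1` A));
  exact: PUray.
Qed.

End noise_outsourcing.

(** * Gluing and costs *)

Section chain.
Context (R : realType) (K : nat) (T : 'I_K.+1 -> ptopologicalType).
Hypothesis cbT : forall k, exists B, @countable_base (T k) B.
Hypothesis brT : forall k, borel_retract R (T k).
Variable mu : forall k, probability (borel (T k)) R.
Variable pi : forall i : 'I_K,
  probability (borel (T (lidx i) * T (ridx i))%type) R.
Hypothesis pi_mu : forall i, couplings (mu (lidx i)) (mu (ridx i)) (pi i).

(** Every [xi k] exists at every stage, so the type of the family does not depend on [n]; those with
    [k > n] are placeholders that need only be measurable. Each step multiplies the space by a copy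
    of [R] whose uniform variable drives the new coordinate. *)
Lemma exists_chain (n : nat) : (n <= K)%N ->
  exists (d : measure_display) (V : measurableType d) (P : probability V R)
         (xi : forall k, V -> borel (T k)),
  [/\ forall k, measurable_fun setT (xi k),
      forall (k : 'I_K.+1) A, (k <= n)%N -> measurable A -> P (xi k @^-1` A) = mu k A &
      forall (i : 'I_K) (C : set (borel (T (lidx i) * T (ridx i))%type)),
        (i < n)%N -> measurable C ->
        P ((fun w => (xi (lidx i) w, xi (ridx i) w)) @^-1` C) = pi i C].
Proof.
elim: n => [_|n IH nK].
  exists _, (borel (T ord0)), (mu ord0), (fun k =>
    if eqVneq ord0 k is EqNotNeq e then fun w => ecast k (borel (T k)) e w
    else fun=> point).
  split => // [k|k A].
    case: eqVneq => [e|_]; last exact: measurable_cst.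
    by case: k / e; exact: measurable_id.
  rewrite leqn0 => k0 mA; case: eqVneq => [e|]; first by case: k / e A {k0} mA.
  by move=> /eqP[]; apply/val_inj/esym/eqP.
have [d [V [P [xi [mxi xiE xipE]]]]] := IH (ltnW nK).
pose i : 'I_K := Ordinal nK.
have [s [g [ms mg gs s01]]] := brT (ridx i).
have [U UE] := exists_uniform R.
have mv : measurable_fun setT
    (fun z : borel (T (lidx i) * T (ridx i))%type => s z.2).
  exact: (measurableT_comp ms (@borel_snd_measurable _ _)).
have [|h mh hE] := noise_outsourcing (pi i) (@borel_fst_measurable _ _) mv UE.
  by move=> z; exact: s01.
have [pi1 pi2] := pi_mu i.
have {}hE := hE _ V P (xi (lidx i)) (mxi _).
have xi1 A : measurable A -> P (xi (lidx i) @^-1` A) = pi i (fst @^-1` A).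
  by move=> mA; rewrite xiE//; exact: esym (pi1 _ mA).
have {}hE A B mA mB := hE xi1 A B mA mB.
pose y (w : V * R) : borel (T (ridx i)) := g (h (xi (lidx i) w.1, w.2)).
have my : measurable_fun setT y.
  apply: (measurableT_comp mg); apply: (measurableT_comp mh).
  apply: measurable_fun_pair; last exact: measurable_snd.
  exact: measurableT_comp.
(* Only coordinate [ridx i] is replaced; the others ignore the fresh variable, so the laws obtained
   so far persist. *)
pose xi' k (w : V * R) : borel (T k) :=
  @dfwith _ (fun k => borel (T k)) (fun k => xi k w.1) (ridx i) (y w) k.
have xi'r : xi' (ridx i) = y by apply/funext => w; rewrite /xi' dfwithin.
have xi'n (k : 'I_K.+1) : (k <= n)%N -> xi' k = fun w => xi k w.1.
  move=> kn; apply/funext => w; rewrite /xi' dfwithout//.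
  by apply/eqP => e; move: kn; rewrite -e /= /bump /= add1n ltnn.
have mxi' k : measurable_fun setT (xi' k).
  have [<-|ik] := eqVneq (ridx i) k; first by rewrite xi'r.
  rewrite (_ : xi' k = fun w => xi k w.1); first exact: measurableT_comp.
  by apply/funext => w; rewrite /xi' dfwithout.
have PU A : measurable A -> (P \x U) [set w | A w.1] = P A.
  move=> mA; rewrite (_ : [set w | _] = A `*` setT).
    rewrite product_measure1E// -[RHS]mule1; congr (_ * _).
    exact: probability_setT.
  by apply/seteqP; split=> w // [].
have mpre k A : measurable A -> measurable (xi k @^-1` A).
  by move=> mA; rewrite -[_ @^-1` _]setTI; exact: mxi.
(* Applied to the preimage of [B] under [g], the real-valued statement becomes one about [B] because
   [g (s x) = x]. *)
have yE A B : measurable A -> measurable B ->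
    (P \x U) [set w | A (xi (lidx i) w.1) /\ B (y w)] =
    pi i (A `*` B).
  move=> mA mB; have := hE A (g @^-1` B) mA.
  rewrite -[X in measurable X]setTI => /(_ (mg measurableT _ mB)) /= e.
  apply: etrans e _; congr (pi i _).
  by apply/seteqP; split=> z /=; rewrite gs.
exists _, (V * R)%type, (P \x U), xi'; split => // [k A|j C].
  rewrite leq_eqVlt ltnS => /orP[/eqP kn|kn] mA; last first.
    by rewrite xi'n//; apply: etrans (PU _ (mpre _ _ mA)) _; exact: xiE.
  have ki : k = ridx i by apply: val_inj; rewrite /= /bump /= add1n.
  rewrite ki in A mA *; rewrite xi'r.
  rewrite (_ : y @^-1` A = [set w | setT (xi (lidx i) w.1) /\ A (y w)]); last first.
    by apply/seteqP; split=> w // [].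
  apply: etrans (yE _ _ measurableT mA) _; apply: etrans (pi2 _ mA); congr (pi i _).
  by apply/seteqP; split=> w // [].
rewrite ltnS leq_eqVlt => /orP[/eqP jn|jn] mC; last first.
  have l1 : (lidx j <= n)%N by exact: ltnW.
  have r1 : (ridx j <= n)%N by rewrite /= /bump /= add1n.
  rewrite (xi'n _ l1) (xi'n _ r1).
  pose D := (fun w => (xi (lidx j) w, xi (ridx j) w)) @^-1` C.
  have mD : measurable D.
    have [Bl HBl] := cbT (lidx j); have [Br HBr] := cbT (ridx j).
    have := measurable_borel_pair HBl HBr (mxi (lidx j)) (mxi (ridx j)).
    by move=> /(_ measurableT _ mC); rewrite setTI.
  by apply: etrans (PU _ mD) _; exact: xipE.
have ji : j = i by exact: val_inj.
rewrite {j jn}ji in C mC *.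
have l1 : (lidx i <= n)%N by [].
have [Bl HBl] := cbT (lidx i); have [Br HBr] := cbT (ridx i).
have mp := measurable_borel_pair HBl HBr (mxi' (lidx i)) (mxi' (ridx i)).
have [Q QE] := exists_distribution (P \x U) mp.
rewrite -[LHS]/(_ _) -QE; apply: (borel_pair_unique HBl HBr) => // A B mA mB.
rewrite QE -yE// (xi'n _ l1) xi'r.
by congr ((P \x U) _); apply/seteqP; split.
Qed.

End chain.

(** * Semicontinuity of the maximum adjacent cost and domination of the path cost *)

Section cost.
Context (R : realType) (K : nat) (X : 'I_K.+1 -> ptopologicalType).
Implicit Types (i : 'I_K) (j k : 'I_K.+1).

Lemma open_actual_some k (U : set (X k)) :
  open U -> open [set x : hat X k | exists2 a, actual x = Some a & U a].
Proof.
rewrite /hat /actual; case: (inner k) => oU.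
  rewrite add_isolated_openE (_ : _ @^-1` _ = U)//.
  by apply/seteqP; split=> a /=; [move=> [_ [<-]]|exists a].
rewrite (_ : mkset _ = U)//.
by apply/seteqP; split=> a /=; [move=> [_ [<-]]|exists a].
Qed.

Lemma open_actual_none k : open [set x : hat X k | actual x = None].
Proof.
rewrite /hat /actual; case: (inner k).
  rewrite add_isolated_openE (_ : _ @^-1` _ = set0); first exact: open0.
  by apply/seteqP; split.
by rewrite (_ : mkset _ = set0); [exact: open0|apply/seteqP; split].
Qed.

Lemma actual_outer k (x : hat X k) : ~~ inner k -> actual x <> None.
Proof. by move: x; rewrite /hat /actual; case: (inner k). Qed.

Lemma lidx_lt_ridx i : (lidx i < ridx i)%N.
Proof. by rewrite /= /bump /= add1n. Qed.

Variable c : forall j k, X j -> X k -> \bar R.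
Arguments c : clear implicits.
Hypothesis c_ge0 : forall j k, (j < k)%N -> forall x y, 0 <= c j k x y.
Hypothesis c_lsc : forall j k, (j < k)%N ->
  lower_semicontinuous (fun p : X j * X k => c j k p.1 p.2).

(** The supremum must not be the one of the empty set, which is [-oo]. If [y] is a cemetery point,
    then [ridx i] is an inner index, and [ord_max] with [point] provides a nonnegative element. *)
Lemma max_adj_cost_ge0 i (x : hat X (lidx i)) (y : hat X (ridx i)) :
  0 <= max_adj_cost c x y.
Proof.
rewrite /max_adj_cost; case: (actual x) => [a|//].
case yE: (actual y) => [b|]; first exact/c_ge0/lidx_lt_ridx.
have rK : (i.+1 < K)%N.
  have : inner (ridx i) by apply: contraT => /(@actual_outer _ y); rewrite yE.
  by rewrite /inner /= /bump /= add1n.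
have iK : (lidx i < @ord_max K)%N by exact: (ltn_ord i).
apply: (le_trans (c_ge0 iK a point)); apply: ereal_sup_ubound.
by exists ord_max, point.
Qed.

(** Lower semicontinuity of the cost: being a cemetery point is a locally constant property, and on
    each piece the cost is a lower semicontinuous [c], a supremum of such functions (the case of
    [U]), or 0. *)
Lemma open_max_adj_cost_gt i (a : R) :
  open [set p : (hat X (lidx i) * hat X (ridx i))%type |
    a%:E < max_adj_cost c p.1 p.2].
Proof.
pose U := [set z : X (lidx i) | a%:E < ereal_sup [set t |
  exists k (b : X k), (i.+1 < k)%N /\ t = c (lidx i) k z b]].
have oU : open U.
  rewrite openE => z /ereal_sup_gt[_ [k [b [ik ->]]] az].
  have lk : (lidx i < k)%N by exact: ltn_trans ik.
  have [V [[V1 V2] /= [V1z V2b] V12] HV] := c_lsc lk (x := (z, b)) az.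
  apply: filterS V1z => z' V1z'; apply: (lt_le_trans (HV (z', b) _)).
    by apply: V12; split => //=; exact: nbhs_singleton.
  by apply: ereal_sup_ubound; exists k, b.
rewrite openE => -[x y] /=; rewrite /max_adj_cost /=.
case xE: (actual x) => [z|]; case yE: (actual y) => [b|] az.
- have [V [[V1 V2] /= [V1z V2b] V12] HV] :=
    c_lsc (lidx_lt_ridx i) (x := (z, b)) az.
  move: V1z V2b; rewrite !nbhsE => -[W1 [oW1 W1z] W1V] [W2 [oW2 W2b] W2V].
  exists ([set x | exists2 a, actual x = Some a & W1 a],
          [set y | exists2 b, actual y = Some b & W2 b]) => /=.
    split; apply: open_nbhs_nbhs; split; [exact: open_actual_some|by exists z| |].
      exact: open_actual_some.
    by exists b.
  move=> [x' y'] [/= [z' -> Wz'] [b' -> Wb']].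
  by apply: (HV (z', b')); apply: V12; split; [exact: W1V|exact: W2V].
- exists ([set x | exists2 a, actual x = Some a & U a],
          [set y | actual y = None]) => /=.
    split; apply: open_nbhs_nbhs; split=> //.
    + exact: open_actual_some.
    + by exists z.
    + exact: open_actual_none.
  by move=> [x' y'] [/= [z' -> Uz'] ->].
- exists ([set x | actual x = None], setT) => /=.
    split; last exact: filterT.
    by apply: open_nbhs_nbhs; split=> //; exact: open_actual_none.
  by move=> [x' y'] [/= -> _].
- exists ([set x | actual x = None], setT) => /=.
    split; last exact: filterT.
    by apply: open_nbhs_nbhs; split=> //; exact: open_actual_none.
  by move=> [x' y'] [/= -> _].
Qed.

Lemma measurable_max_adj_cost i : measurable_fun setT
  (fun p : borel (hat X (lidx i) * hat X (ridx i))%type =>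
     max_adj_cost c p.1 p.2).
Proof.
apply: (measurability _ (ErealGenOInfty.measurableE R)).
move=> _ [_ [a ->] <-]; rewrite setTI preimage_itvoy.
by apply: borel_open; exact: open_max_adj_cost_gt.
Qed.

Lemma active_nth (omega : path_space X) (l : nat) :
  let s := active omega in (l.+1 < size s)%N ->
  [/\ (nth ord0 s l < nth ord0 s l.+1)%N,
      isSome (actual (omega (nth ord0 s l))),
      isSome (actual (omega (nth ord0 s l.+1))) &
      forall k, (nth ord0 s l < k < nth ord0 s l.+1)%N ->
        actual (omega k) = None].
Proof.
move=> s ls.
have sact k : (k \in s) = isSome (actual (omega k)).
  by rewrite mem_filter mem_enum andbT.
have ss : sorted (fun j k : 'I_K.+1 => (j < k)%N) s.
  apply: sorted_filter; first by move=> ? ? ?; exact: ltn_trans.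
  rewrite -[sorted _ _]/(sorted (relpre val ltn) (enum 'I_K.+1)) -sorted_map.
  by rewrite val_enum_ord iota_ltn_sorted.
have smono m1 m2 : (m1 < m2 < size s)%N -> (nth ord0 s m1 < nth ord0 s m2)%N.
  move=> /andP[m12 m2s].
  apply: (sorted_ltn_nth (leT := fun j k : 'I_K.+1 => (j < k)%N)) => //.
  - by move=> ? ? ?; exact: ltn_trans.
  - by rewrite inE (ltn_trans m12).
split.
- by apply: smono; rewrite ltnSn.
- by rewrite -sact mem_nth// ltnW.
- by rewrite -sact mem_nth.
move=> k /andP[lk kl]; case ak: (actual (omega k)) => [a|//]; exfalso.
have ks : k \in s by rewrite sact ak.
have ik : (index k s < size s)%N by rewrite index_mem.
have [il|] := leqP (index k s) l.
  move: lk; rewrite ltnNge => /negP; apply.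
  rewrite -{1}(nth_index ord0 ks); move: il; rewrite leq_eqVlt => /predU1P[->//|il].
  by apply/ltnW/smono; rewrite il ltnW.
rewrite leq_eqVlt => /predU1P[le|li].
  by move: kl; rewrite le nth_index// ltnn.
by have := smono _ _ (introT andP (conj li ik)); rewrite nth_index// ltnNge ltnW.
Qed.

Lemma hop_cost_le_max_adj (omega : path_space X) i k : (i < k)%N ->
  isSome (actual (omega (lidx i))) -> isSome (actual (omega k)) ->
  (forall m : 'I_K.+1, (i < m < k)%N -> actual (omega m) = None) ->
  hop_cost c (omega (lidx i)) (omega k) <=
  max_adj_cost c (omega (lidx i)) (omega (ridx i)).
Proof.
move=> ik; rewrite /hop_cost /max_adj_cost.
case: (actual (omega (lidx i))) => // a _.
have [<-|rk] := eqVneq (ridx i) k.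
  by case: (actual _).
case: (actual (omega k)) => // b _ none.
have ik1 : (i.+1 < k)%N.
  rewrite ltn_neqAle ik andbT; apply: contraNneq rk => e.
  by apply/eqP/val_inj; rewrite /= /bump /= add1n.
rewrite none; last by rewrite /= /bump /= add1n ltnSn.
by apply: ereal_sup_ubound; exists k, b.
Qed.

Lemma path_cost_ge0 (omega : path_space X) : 0 <= path_cost c omega.
Proof.
rewrite /path_cost big_mkord; apply: sume_ge0 => l _.
have [|lt _ _ _] := @active_nth omega l; first by rewrite -ltn_predRL.
by rewrite /hop_cost; do 2 case: actual => // ?; exact: c_ge0.
Qed.

(** Each hop is charged to the adjacent cost at the index [phi l] where it starts. Distinct hops
    start at distinct indices, and the uncharged terms are nonnegative. *)
Lemma path_cost_le (omega : path_space X) :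
  path_cost c omega <=
  \sum_(i < K) max_adj_cost c (omega (lidx i)) (omega (ridx i)).
Proof.
rewrite /path_cost big_mkord; set s := active omega; set n := (size s).-1.
have ls (l : 'I_n) : (l.+1 < size s)%N by rewrite -ltn_predRL.
have /fin_all_exists[phi phiE] :
    forall l : 'I_n, exists i, lidx i = nth ord0 s l.
  move=> l; have [lt _ _ _] := active_nth (ls l).
  have iK : (nth ord0 s l < K)%N.
    by apply: (leq_trans lt); rewrite -ltnS ltn_ord.
  by exists (Ordinal iK); apply: val_inj.
have phi_inj : injective phi.
  move=> l m lm; apply/val_inj/eqP.
  rewrite -(nth_uniq ord0 (ltnW (ls l)) (ltnW (ls m))).
    by rewrite -!phiE lm.
  by rewrite filter_uniq// enum_uniq.
apply: (@le_trans _ _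
  (\sum_(l < n) max_adj_cost c (omega (lidx (phi l))) (omega (ridx (phi l))))).
  apply: lee_sum => l _.
  have [+ + + +] := active_nth (ls l); rewrite -/s -phiE.
  exact: hop_cost_le_max_adj.
pose f i := max_adj_cost c (omega (lidx i)) (omega (ridx i)).
rewrite (eq_bigl (fun l => l \in [set: 'I_n]%SET)); last by move=> l; rewrite inE.
rewrite -(big_imset f) /=; last by move=> ? ? _ _; exact: phi_inj.
by apply: lee_sum_nneg_subset => // i _; exact: max_adj_cost_ge0.
Qed.

End cost.

(* Measurability of [f] and [g] is not assumed: the integral of a nonnegative
   function is a supremum over simple functions below it. *)
Lemma ge0_le_integral_all d (T : measurableType d) (R : realType)
    (mu : {measure set T -> \bar R}) (f g : T -> \bar R) :
  (forall x, 0 <= f x) -> (forall x, f x <= g x) ->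
  \int[mu]_x f x <= \int[mu]_x g x.
Proof.
move=> f0 fg; have g0 x : 0 <= g x by exact: le_trans (fg x).
rewrite !ge0_integralTE//; apply: le_ereal_sup => _ [h hf <-].
by exists h => // x; exact: le_trans (fg x).
Qed.

Theorem theorem2p1 (R : realType) (K : nat) (hK : (1 <= K)%N)
    (X : 'I_K.+1 -> ptopologicalType)
    (hX : forall k : 'I_K.+1, polish R (X k))
    (c : forall i j : 'I_K.+1, X i -> X j -> \bar R)
    (c_ge0 : forall i j : 'I_K.+1, (i < j)%N ->
       forall (x : X i) (y : X j), 0 <= c i j x y)
    (c_lsc : forall i j : 'I_K.+1, (i < j)%N ->
       lower_semicontinuous (fun p : X i * X j => c i j p.1 p.2))
    (mu0 : probability (borel (hat X ord0)) R)
    (muK : probability (borel (hat X ord_max)) R) :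
  (exists mu : forall k : 'I_K.+1, probability (borel (hat X k)) R,
     [/\ mu ord0 = mu0, mu ord_max = muK &
         \sum_(i < K)
           max_adj_transport c (mu (lidx i)) (mu (ridx i)) < +oo]) ->
  optimal_value c mu0 muK \is a fin_num.
Proof.
move=> [mu [mu0E muKE sum_fin]].
have cb k := @hat_countable_base R K X hX k.
have br k := @hat_borel_retract R K X hX k.
have mac_ge0 i x y := @max_adj_cost_ge0 R K X c c_ge0 i x y.
have t0 i : 0 <= max_adj_transport c (mu (lidx i)) (mu (ridx i)).
  by apply: le_ereal_inf_tmp => _ [pi _ <-]; exact: integral_ge0.
have t_fin i : max_adj_transport c (mu (lidx i)) (mu (ridx i)) < +oo.
  by apply: le_lt_trans sum_fin; rewrite (bigD1 i)//= leeDl// sume_ge0.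
(* Nonnegative terms with a finite sum are finite, and a finite infimum already yields a coupling of
   finite cost; optimal couplings are never invoked. *)
have /all_sig2[pi pic pi_fin] : forall i : 'I_K,
    { rho : probability (borel (hat X (lidx i) * hat X (ridx i))%type) R |
      couplings (mu (lidx i)) (mu (ridx i)) rho &
      \int[rho]_p max_adj_cost c p.1 p.2 < +oo}.
  move=> i; apply: cid2.
  by have /ereal_inf_lt[_ [rho rhoc <-] rho_fin] := t_fin i; exists rho.
have [d [V [P [xi [mxi xiE xipE]]]]] := exists_chain cb br pic (leqnn K).
have mxi' := measurable_borel_prod cb mxi.
have [Pi PiE] := exists_distribution P mxi'.
have Pi_mu : path_couplings mu Pi.
  by move=> k A mA; apply: etrans (PiE _) _; apply: xiE => //; rewrite -ltnS.
have int_fin : \int[Pi]_omega path_cost c omega < +oo.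
  apply: (@le_lt_trans _ _ (\int[Pi]_omega
      \sum_(i < K) max_adj_cost c (omega (lidx i)) (omega (ridx i)))).
    apply: ge0_le_integral_all => omega; first exact: path_cost_ge0.
    exact: path_cost_le.
  pose pr i (omega : borel (path_space X)) :
    borel (hat X (lidx i) * hat X (ridx i))%type :=
    (omega (lidx i), omega (ridx i)).
  have mpr i : measurable_fun setT (pr i).
    have [Bl HBl] := cb (lidx i); have [Br HBr] := cb (ridx i).
    exact: (measurable_borel_pair HBl HBr (@borel_proj_measurable _ _ _)
      (@borel_proj_measurable _ _ _)).
  have mac i := measurable_max_adj_cost c_lsc i.
  (* The bound splits into terms depending on one adjacent pair each, whose law under [Pi] is
     [pi i]. *)
  rewrite ge0_integral_sum//; last first.
    by move=> i; exact: (measurableT_comp (mac i) (mpr i)).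
  apply: lte_sum_pinfty => i _.
  have := @integral_law _ _ _ _ _ Pi (pi i) (pr i) setT
    (fun p => max_adj_cost c p.1 p.2) (mpr i).
  rewrite /= => <- //; [exact: pi_fin| |exact: mac].
  by move=> B mB; apply: etrans (esym (xipE i B (ltn_ord i) mB)) (esym (PiE _)).
rewrite ge0_fin_numE.
  apply: le_lt_trans int_fin; apply: ereal_inf_lbound.
  by exists mu, Pi.
apply: le_ereal_inf_tmp => _ [mu' [pi' [_ _ _ ->]]].
by apply: integral_ge0 => omega _; exact: path_cost_ge0.
Qed.
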